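(* Existential formulae are concise in torus knot groups. That is, for any coprime integers $n,m>1$, with $T(n,m)=\langle x,y\mid x^n=y^m\rangle$, and every existential formula $\varphi$, if $T(n,m)_\varphi$ is finite then the subgroup it generates is finite.
   Context: A formula is a first-order formula $\varphi(x)$ in the language of groups $\{1,\cdot,{}^{-1}\}$ with one free variable $x$ and without parameters. It is existential if the only quantifier occurring is $\exists$, i.e. it is equivalent to one of the form $\exists\overline y:\bigvee_{j=1}^m(w_{j,1}(x,\overline y)\#_{j,1}1\wedge\cdots\wedge w_{j,k_j}(x,\overline y)\#_{j,k_j}1)$, with each $w_{j,i}$ a (group) word and $\#_{j,i}\in\{=,\neq\}$. For a group $G$, $G_\varphi:=\{g\in G\mid\varphi(g)\text{ is true in }G\}$ and $\varphi(G):=\langle G_\varphi\rangle$. A formula $\varphi$ is concise in a group $G$ (resp. a class of groups) if finiteness of $G_\varphi$ implies finiteness of $\varphi(G)$ (resp. for every $G$ in the class). *)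

(* Defs.v *)
From HB Require Import structures.
From mathcomp Require Import all_boot.
From mathcomp Require Import mathcomp_extra boolp classical_sets cardinality.

Set Implicit Arguments.
Unset Strict Implicit.
Unset Printing Implicit Defensive.

Local Open Scope classical_set_scope.
Local Open Scope group_scope.
Local Open Scope quotient_scope.

(* Group presentations. A letter (x, b) stands for x if b = false and for the
   formal inverse of x if b = true. *)

Definition word (X : Type) := seq (X * bool).

Definition inv_word (X : Type) (w : word X) : word X :=
  [seq (a.1, ~~ a.2) | a <- rev w].

Section Presentation.
Variables (X : choiceType) (R : word X -> word X -> Prop).

Inductive pres_eq : word X -> word X -> Prop :=
| PresRel u v : R u v -> pres_eq u v
| PresCancel x b : pres_eq [:: (x, b); (x, ~~ b)] [::]
| PresCat u u' v v' : pres_eq u u' -> pres_eq v v' -> pres_eq (u ++ v) (u' ++ v')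
| PresRefl u : pres_eq u u
| PresSym u v : pres_eq u v -> pres_eq v u
| PresTrans u v w : pres_eq u v -> pres_eq v w -> pres_eq u w.

Definition pres_eqb (u v : word X) : bool := `[< pres_eq u v >].

Lemma pres_eqb_refl : reflexive pres_eqb.
Proof. by move=> u; apply/asboolP; exact: PresRefl. Qed.

Lemma pres_eqb_sym : symmetric pres_eqb.
Proof.
by move=> u v; apply/idP/idP => /asboolP uv; apply/asboolP; exact: PresSym.
Qed.

Lemma pres_eqb_trans : transitive pres_eqb.
Proof.
by move=> v u w /asboolP uv /asboolP vw; apply/asboolP; exact: PresTrans uv vw.
Qed.

Canonical pres_equiv :=
  EquivRel pres_eqb pres_eqb_refl pres_eqb_sym pres_eqb_trans.

(* The group < X | u = v for all u, v such that R u v >. *)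
Definition presented := {eq_quot pres_equiv}.

HB.instance Definition _ := Choice.on presented.
HB.instance Definition _ := EqQuotient.on presented.

Lemma presP (u v : word X) :
  (\pi_presented u = \pi_presented v) <-> pres_eq u v.
Proof. by split => [/eqmodP/asboolP|uv]; [|apply/eqmodP/asboolP]. Qed.

Lemma pres_eq_mulVw (w : word X) : pres_eq (inv_word w ++ w) [::].
Proof.
rewrite /inv_word; elim: w => [|[x b] w IHw]; first exact: PresRefl.
rewrite rev_cons map_rcons cat_rcons /=; apply: PresTrans IHw.
apply: PresCat (PresRefl _) _.
rewrite -[X in pres_eq _ X]cat0s -[_ :: w]/([:: (x, b)] ++ w) -cat1s catA.
apply: PresCat (PresRefl _).
by have := PresCancel x (~~ b); rewrite negbK.
Qed.

Lemma inv_wordK (w : word X) : inv_word (inv_word w) = w.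
Proof.
rewrite /inv_word -map_rev revK -map_comp -[RHS]map_id.
by apply: eq_map => -[x b] /=; rewrite negbK.
Qed.

Lemma pres_eq_mulwV (w : word X) : pres_eq (w ++ inv_word w) [::].
Proof. by have := pres_eq_mulVw (inv_word w); rewrite inv_wordK. Qed.

Lemma pres_eq_inv (u v : word X) :
  pres_eq u v -> pres_eq (inv_word u) (inv_word v).
Proof.
move=> uv; apply: (@PresTrans _ (inv_word u ++ (v ++ inv_word v))).
  rewrite -[X in pres_eq X _]cats0; apply: PresCat (PresRefl _) _.
  exact/PresSym/pres_eq_mulwV.
rewrite catA -[X in pres_eq _ X]cat0s; apply: PresCat (PresRefl _).
apply: PresTrans (pres_eq_mulVw u).
exact: PresCat (PresRefl _) (PresSym uv).
Qed.

Definition pres_one : presented := \pi_presented [::].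
Definition pres_mul (a b : presented) : presented := \pi_presented (repr a ++ repr b).
Definition pres_inv (a : presented) : presented := \pi_presented (inv_word (repr a)).

Lemma pres_repr (u : word X) : pres_eq (repr (\pi_presented u)) u.
Proof. by apply/presP; rewrite reprK. Qed.

Lemma pres_mul_pi (u v : word X) :
  pres_mul (\pi_presented u) (\pi_presented v) = \pi_presented (u ++ v).
Proof. by apply/presP; apply: PresCat; exact: pres_repr. Qed.

Lemma pres_inv_pi (u : word X) :
  pres_inv (\pi_presented u) = \pi_presented (inv_word u).
Proof. by apply/presP/pres_eq_inv/pres_repr. Qed.

Lemma pres_mulA : associative pres_mul.
Proof.
elim/quotW=> u; elim/quotW=> v; elim/quotW=> w.
by rewrite (pres_mul_pi v w) (pres_mul_pi u v) !pres_mul_pi catA.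
Qed.

Lemma pres_mul1 : left_id pres_one pres_mul.
Proof. by elim/quotW=> u; rewrite /pres_one pres_mul_pi. Qed.

Lemma pres_mulr1 : right_id pres_one pres_mul.
Proof. by elim/quotW=> u; rewrite /pres_one pres_mul_pi cats0. Qed.

Lemma pres_mulV : left_inverse pres_one pres_inv pres_mul.
Proof.
elim/quotW=> u; rewrite pres_inv_pi pres_mul_pi.
exact/presP/pres_eq_mulVw.
Qed.

Lemma pres_mulrV : right_inverse pres_one pres_inv pres_mul.
Proof.
elim/quotW=> u; rewrite pres_inv_pi pres_mul_pi.
exact/presP/pres_eq_mulwV.
Qed.

HB.instance Definition _ := isGroup.Build presented
  pres_mulA pres_mul1 pres_mulr1 pres_mulV pres_mulrV.

Definition pres_gen (x : X) : presented := \pi_presented [:: (x, false)].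

End Presentation.

Inductive torus_gen := tx | ty.

Definition bool_of_torus_gen (a : torus_gen) := if a is tx then true else false.
Definition torus_gen_of_bool (b : bool) := if b then tx else ty.

Lemma bool_of_torus_genK : cancel bool_of_torus_gen torus_gen_of_bool.
Proof. by case. Qed.

HB.instance Definition _ := Choice.copy torus_gen (can_type bool_of_torus_genK).

Definition torus_rel (n m : nat) (u v : word torus_gen) : Prop :=
  u = nseq n (tx, false) /\ v = nseq m (ty, false).

(* T(n, m) = < x, y | x^n = y^m > *)
Definition torus_knot_group (n m : nat) : groupType :=
  presented (torus_rel n m).

(* First-order formulae without parameters in the language of groups. The type
   V is the type of variables that may occur free; a quantifier binds the
   variable None of option V. *)

Inductive term (V : Type) :=
| Var of V
| One
| Mul of term V & term V
| Inv of term V.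
Arguments One {V}.

Inductive formula (V : Type) :=
| FTrue
| FFalse
| FEq of term V & term V
| FNot of formula V
| FAnd of formula V & formula V
| FOr of formula V & formula V
| FImp of formula V & formula V
| FEx of formula (option V)
| FAll of formula (option V).
Arguments FTrue {V}.
Arguments FFalse {V}.

Fixpoint eval (G : groupType) (V : Type) (e : V -> G) (t : term V) : G :=
  match t with
  | Var v => e v
  | One => 1
  | Mul t1 t2 => eval e t1 * eval e t2
  | Inv t1 => (eval e t1)^-1
  end.

Fixpoint sat (G : groupType) (V : Type) (e : V -> G) (f : formula V) : Prop :=
  match f with
  | FTrue => True
  | FFalse => False
  | FEq t u => eval e t = eval e u
  | FNot f1 => ~ sat e f1
  | FAnd f1 f2 => sat e f1 /\ sat e f2
  | FOr f1 f2 => sat e f1 \/ sat e f2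
  | FImp f1 f2 => sat e f1 -> sat e f2
  | FEx f1 => exists y : G, sat (oapp e y) f1
  | FAll f1 => forall y : G, sat (oapp e y) f1
  end.

Definition equivalent (V : Type) (f g : formula V) : Prop :=
  forall (G : groupType) (e : V -> G), sat e f <-> sat e g.

(* (w, true) encodes w = 1, and (w, false) encodes w <> 1. *)
Definition literal (V : Type) (l : term V * bool) : formula V :=
  if l.2 then FEq l.1 One else FNot (FEq l.1 One).

Definition conjunction (V : Type) (s : seq (formula V)) : formula V :=
  foldr (@FAnd V) FTrue s.

Definition disjunction (V : Type) (s : seq (formula V)) : formula V :=
  foldr (@FOr V) FFalse s.

Definition dnf (V : Type) (L : seq (seq (term V * bool))) : formula V :=
  disjunction [seq conjunction [seq literal l | l <- c] | c <- L].

(* Formulae that are literally of the form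
   exists y_1, ..., exists y_r, \/_j /\_i w_{j,i} #_{j,i} 1. *)
Inductive existential_form (V : Type) : formula V -> Prop :=
| ExistentialDnf L : existential_form (dnf L)
| ExistentialEx (f : formula (option V)) :
    existential_form f -> existential_form (FEx f).

Definition existential (V : Type) (f : formula V) : Prop :=
  exists2 g, existential_form g & equivalent f g.

(* A formula in one free variable is an element of formula unit. *)

Definition solutions (phi : formula unit) (G : groupType) : set G :=
  [set g : G | sat (fun=> g) phi].

Arguments solutions : clear implicits.

Definition generated (G : groupType) (A : set G) : set G :=
  smallest (fun H : set G => group_closed (mem H)) A.

Definition concise (phi : formula unit) (G : groupType) : Prop :=
  finite_set (solutions phi G) -> finite_set (generated (solutions phi G)).

(* Main.v *)
(* Existential formulae are preserved by injective endomorphisms, so it suffices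
   to move a nontrivial solution g of T(n, m) to infinitely many places. Let z be
   the central element x^n = y^m and let deg : T(n, m) -> Z send x to m and y to n.
   The endomorphism x |-> x^(1 + nm), y |-> y^(1 + nm) multiplies each element by
   a power of z and multiplies degrees by 1 + nm, hence is injective; its iterates
   handle the case deg g <> 0. If deg g = 0, then g is not a power of z, because
   deg z = nm; so its image in the free product C_n * C_m = T(n, m) / <z> is
   nontrivial, and since n and m are not both 2, g has conjugates with
   arbitrarily long normal forms. *)

Require Import Defs.
From mathcomp Require Import all_boot.
From mathcomp Require Import ssralg ssrint zify.
From mathcomp Require Import boolp classical_sets cardinality.

Set Implicit Arguments.
Unset Strict Implicit.
Unset Printing Implicit Defensive.

Local Open Scope classical_set_scope.
Local Open Scope group_scope.
Local Open Scope quotient_scope.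

(** * Existential formulae under injective homomorphisms *)

Section Morphisms.
Variables (G H : groupType) (s : G -> H).
Hypothesis sM : {morph s : x y / x * y}.

Lemma morph_one : s 1 = 1.
Proof. by apply: (@mulgI _ (s 1)); rewrite -sM !mulg1. Qed.

Lemma morph_inv : {morph s : x / x^-1}.
Proof.
by move=> x; apply: (@mulgI _ (s x)); rewrite -sM !mulgV morph_one.
Qed.

Lemma morph_eval V (e : V -> G) t : eval (s \o e) t = s (eval e t).
Proof.
elim: t => [//||t IHt u IHu|t IHt] /=; first by rewrite morph_one.
  by rewrite sM IHt IHu.
by rewrite morph_inv IHt.
Qed.

Hypothesis s_inj : injective s.

Lemma sat_morph_dnf V (e : V -> G) L : sat (s \o e) (dnf L) <-> sat e (dnf L).
Proof.
elim: L => [//|c L IHL] /=.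
suff -> : sat (s \o e) (conjunction [seq literal l | l <- c]) <->
          sat e (conjunction [seq literal l | l <- c]) by rewrite IHL.
elim: c => [//|[t b] c IHc] /=; rewrite IHc.
suff -> : sat (s \o e) (literal (t, b)) <-> sat e (literal (t, b)) by [].
have st1 : eval (s \o e) t = 1 <-> eval e t = 1.
  rewrite morph_eval; split=> [st|->]; last exact: morph_one.
  by apply: s_inj; rewrite st morph_one.
by case: b => /=; rewrite st1.
Qed.

(** Witnesses are carried along [s], and injectivity preserves the negated equations. Only one
    implication passes the quantifiers, as [s] may fail to be surjective. *)
Lemma sat_morph_existential V (e : V -> G) f :
  existential_form f -> sat e f -> sat (s \o e) f.
Proof.
move=> ex_f; elim: ex_f e => {V f} [V L|V f _ IHf] e; first by rewrite sat_morph_dnf.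
move=> [y /IHf sat_f]; exists (s y).
by rewrite (_ : oapp _ _ = s \o oapp e y) //; apply: funext; case.
Qed.

End Morphisms.

Lemma solutions_morph (G : groupType) (s : G -> G) (phi : formula unit) g :
    {morph s : x y / x * y} -> injective s -> existential phi ->
  solutions phi G g -> solutions phi G (s g).
Proof.
move=> sM s_inj [psi ex_psi eq_phi]; rewrite /solutions /= !eq_phi.
exact: (sat_morph_existential sM s_inj ex_psi).
Qed.

(** * Finite and trivial solution sets *)

Lemma finite_set_bounded (T : choiceType) (A : set T) (mu : T -> nat) :
  finite_set A -> exists B, forall x, A x -> mu x <= B.
Proof.
move=> /finite_seqP[s ->]; exists (\max_(x <- s) mu x) => x xs.
exact: leq_bigmax_seq.
Qed.

Lemma concise_trivial (G : groupType) (phi : formula unit) :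
    (forall g, solutions phi G g -> g = 1) -> concise phi G.
Proof.
move=> sol1 _; apply: (@sub_finite_set _ _ [set 1]); last exact: finite_set1.
move=> g; apply; split=> [|h /sol1 //]; split; first by rewrite inE.
by move=> x y; rewrite !inE => -> ->; rewrite mulgV.
Qed.

(** * Homomorphisms from a presented group *)

Section Presented.
Variables (X : choiceType) (R : word X -> word X -> Prop).
Local Notation P := (presented R).

Lemma presM (u v : word X) : (\pi_P u : P) * \pi_P v = \pi_P (u ++ v).
Proof. exact: pres_mul_pi. Qed.

Lemma presV (u : word X) : (\pi_P u : P)^-1 = \pi_P (inv_word u).
Proof. exact: pres_inv_pi. Qed.

Definition letter_val (G : groupType) (phi : X -> G) (a : X * bool) : G :=
  if a.2 then (phi a.1)^-1 else phi a.1.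

Lemma pi_word (u : word X) :
  \pi_P u = \prod_(a <- u) letter_val (pres_gen R) a.
Proof.
elim: u => [|[x b] u IHu]; first by rewrite big_nil.
rewrite big_cons -IHu -cat1s -presM; congr (_ * _).
by case: b; rewrite /letter_val //= /pres_gen presV.
Qed.

Lemma presented_ind (Q : P -> Prop) :
    Q 1 -> (forall x g, Q g -> Q (pres_gen R x * g)) ->
    (forall x g, Q g -> Q ((pres_gen R x)^-1 * g)) ->
  forall g, Q g.
Proof.
move=> Q1 Qgen Qinv; elim/quotW=> u; rewrite pi_word.
elim: u => [|[x b] u IHu]; rewrite ?big_nil // big_cons.
by case: b; [exact: Qinv|exact: Qgen].
Qed.

(* Values in a monoid rather than in a group: this also covers [+%R] on [int]. *)
Lemma pres_eq_big (M : Type) (idx : M) (op : Monoid.law idx)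
    (phi : X * bool -> M) (u v : word X) :
    (forall u v, R u v ->
       \big[op/idx]_(a <- u) phi a = \big[op/idx]_(a <- v) phi a) ->
    (forall x b, op (phi (x, b)) (phi (x, ~~ b)) = idx) ->
  pres_eq R u v -> \big[op/idx]_(a <- u) phi a = \big[op/idx]_(a <- v) phi a.
Proof.
move=> phiR phiV; elim=> {u v} [u v /phiR //|x b|u u' v v' _ IHu _ IHv|//|//|].
- by rewrite big_cons big_seq1 big_nil phiV.
- by rewrite !big_cat IHu IHv.
- by move=> u v w _ -> _ ->.
Qed.

(** The map of the universal property, computed on a chosen representative; it is independent of
    that choice once [phi] respects the relations. *)
Definition pres_lift (G : groupType) (phi : X -> G) (g : P) : G :=
  \prod_(a <- repr g) letter_val phi a.

Section Lift.
Variables (G : groupType) (phi : X -> G).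
Hypothesis phiR : forall u v, R u v ->
  \prod_(a <- u) letter_val phi a = \prod_(a <- v) letter_val phi a.

Lemma pres_lift_pi (u : word X) :
  pres_lift phi (\pi_P u) = \prod_(a <- u) letter_val phi a.
Proof.
apply: pres_eq_big (pres_repr R u) => // x [];
  by rewrite /letter_val /= ?mulgV ?mulVg.
Qed.

Lemma pres_liftM : {morph pres_lift phi : g h / g * h}.
Proof.
elim/quotW=> u; elim/quotW=> v.
by rewrite presM !pres_lift_pi big_cat.
Qed.

Lemma pres_lift_gen x : pres_lift phi (pres_gen R x) = phi x.
Proof. by rewrite pres_lift_pi big_seq1. Qed.

End Lift.

End Presented.

(** * The torus knot group and its central element *)

Definition flip b := if b is tx then ty else tx.

Lemma flip_neq b : flip b != b. Proof. by case: b. Qed.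

Lemma neq_flip b c : (b != c) = (b == flip c). Proof. by case: b; case: c. Qed.

Lemma flipK : involutive flip. Proof. by case. Qed.

Section TorusKnot.
Variables n m : nat.
Hypotheses (n_gt1 : 1 < n) (m_gt1 : 1 < m).
Local Notation T := (torus_knot_group n m).
Local Notation "\piT u" := (\pi_(presented (torus_rel n m)) u) (at level 10).

Definition gen b : T := pres_gen (torus_rel n m) b.
Definition ord b := if b is tx then n else m.
(** The class of a regular fibre of the Seifert fibration of the knot complement. *)
Definition fiber : T := gen tx ^+ n.

Lemma ord_gt1 b : 1 < ord b. Proof. by case: b. Qed.

Lemma ord_gt0 b : 0 < ord b. Proof. exact: ltnW (ord_gt1 b). Qed.

Lemma nm_gt0 : 0 < (n * m)%N.
Proof. by rewrite muln_gt0 (ltnW n_gt1) ltnW. Qed.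

Lemma torus_lift_rel (G : groupType) (phi : torus_gen -> G) u v :
    phi tx ^+ n = phi ty ^+ m -> torus_rel n m u v ->
  \prod_(a <- u) letter_val phi a = \prod_(a <- v) letter_val phi a.
Proof.
by move=> phi_nm [-> ->]; rewrite !big_nseq !iter_mulg_1 /letter_val /=.
Qed.

Lemma gen_ord b : gen b ^+ ord b = fiber.
Proof.
case: b => //=; rewrite /fiber.
have /presP : pres_eq (torus_rel n m) (nseq n (tx, false)) (nseq m (ty, false)).
  exact: PresRel.
by rewrite !pi_word !big_nseq !iter_mulg_1.
Qed.

Lemma fiber_central g : commute fiber g.
Proof.
have fiber_gen b : commute fiber (gen b).
  by rewrite -(gen_ord b); apply/commute_sym/commuteX/commute_refl.
elim/presented_ind: g => [|b g IHg|b g IHg]; first exact: commute1.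
  exact: commuteM.
by apply: commuteM => //; apply: commuteV.
Qed.

(** Quotients of two natural powers encode the integer powers. *)
Definition in_fiber (c : T) := exists k l, c = fiber ^+ k / fiber ^+ l.

Lemma in_fiber_commute c g : in_fiber c -> commute c g.
Proof.
move=> [k [l ->]]; apply/commute_sym/commuteM; last apply/commuteV;
  exact/commuteX/commute_sym/fiber_central.
Qed.

Lemma in_fiberX k : in_fiber (fiber ^+ k).
Proof. by exists k, 0; rewrite divg1. Qed.

Lemma in_fiberM c d : in_fiber c -> in_fiber d -> in_fiber (c * d).
Proof.
move=> [k [l ->]] [k' [l' ->]]; exists (k + k'), (l' + l).
rewrite !expgnDr invgM !mulgA; congr (_ * _); rewrite -!mulgA; congr (_ * _).
apply: commuteX; apply/commute_sym/commuteV/commuteX; exact: commute_refl.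
Qed.

Lemma in_fiberV c : in_fiber c -> in_fiber c^-1.
Proof. by move=> [k [l ->]]; exists l, k; rewrite invgF. Qed.

Lemma in_fiber1 : in_fiber 1. Proof. exact: (in_fiberX 0). Qed.

Lemma in_fiber_conj c g : in_fiber c -> c ^ g = c.
Proof. by move=> /in_fiber_commute cg; rewrite conjgE cg mulKg. Qed.

(** * The degree homomorphism to the integers *)

Definition letter_deg (a : torus_gen * bool) : int :=
  (let d := (if a.1 is tx then m else n)%:Z in if a.2 then - d else d)%R.

Definition deg (g : T) : int := (\sum_(a <- repr g) letter_deg a)%R.

(** The weights [m] for [tx] and [n] for [ty] give both sides of the relation degree [n * m]. *)
Lemma deg_pi u : deg (\piT u) = (\sum_(a <- u) letter_deg a)%R.
Proof.
apply: pres_eq_big (pres_repr (torus_rel n m) u) => [_ _ [-> ->]|x b].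
  by rewrite !big_nseq !GRing.iter_addr_0 /letter_deg /=; lia.
by rewrite /letter_deg; case: b => /=; lia.
Qed.

Lemma degM : {morph deg : g h / (g * h)%g >-> (g + h)%R}.
Proof.
elim/quotW=> u; elim/quotW=> v.
by rewrite presM !deg_pi big_cat.
Qed.

Lemma deg1 : deg 1 = 0%R.
Proof. by have := degM 1 1; rewrite mulg1; lia. Qed.

Lemma degV g : deg g^-1 = (- deg g)%R.
Proof. by have := degM g g^-1; rewrite mulgV deg1; lia. Qed.

Lemma degX g k : deg (g ^+ k) = (deg g * k%:Z)%R.
Proof.
by elim: k => [|k IHk]; rewrite ?deg1 ?expgS ?degM ?IHk; lia.
Qed.

Lemma deg_gen b : deg (gen b) = (if b is tx then m else n)%:Z%R.
Proof. by rewrite deg_pi big_seq1. Qed.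

Lemma deg_fiber : deg fiber = (n * m)%:Z%R.
Proof. by rewrite degX deg_gen; lia. Qed.

Lemma in_fiber_deg0 c : in_fiber c -> deg c = 0%R -> c = 1.
Proof.
move=> [k [l ->]]; rewrite degM degV (degX _ k) (degX _ l) deg_fiber => kl.
suff -> : k = l by rewrite mulgV.
by move: (n * m)%N nm_gt0 kl => N; nia.
Qed.

(** * The endomorphism raising both generators to the power 1 + nm *)

Definition stretch : T -> T :=
  pres_lift (R := torus_rel n m) (fun b => gen b ^+ (n * m).+1).

Lemma stretch_rel u v : torus_rel n m u v ->
  \prod_(a <- u) letter_val (fun b => gen b ^+ (n * m).+1) a =
  \prod_(a <- v) letter_val (fun b => gen b ^+ (n * m).+1) a.
Proof.
by apply: torus_lift_rel; rewrite !(expgnAC _ (n * m).+1) (gen_ord tx) (gen_ord ty).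
Qed.

Lemma stretchM : {morph stretch : g h / g * h}.
Proof. exact: pres_liftM stretch_rel. Qed.

Lemma stretch_gen b : stretch (gen b) = gen b ^+ (n * m).+1.
Proof. exact: (pres_lift_gen stretch_rel). Qed.

(** Both [n] and [m] divide [n * m], so a generator changes only by a power of [fiber]; these
    central factors are collected on the right. *)
Lemma stretch_fiber g : exists2 c, in_fiber c & stretch g = g * c.
Proof.
have stretch_b b : exists2 c, in_fiber c & stretch (gen b) = gen b * c.
  exists (fiber ^+ ((n * m) %/ ord b)); first exact: in_fiberX.
  rewrite stretch_gen expgS -(gen_ord b) -expgnA [(ord b * _)%N]mulnC divnK //.
  by case: b => /=; [exact: dvdn_mulr | exact: dvdn_mull].
have mul_c x y c d : in_fiber c -> x * c * (y * d) = x * y * (c * d).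
  by move=> cF; rewrite !mulgA -(mulgA x c) (in_fiber_commute y cF) !mulgA.
elim/presented_ind: g => [|b g [c cF sg]|b g [c cF sg]].
- by exists 1; [exact: in_fiber1 | rewrite mulg1; exact: morph_one stretchM].
- have [d dF sb] := stretch_b b.
  by exists (d * c); [exact: in_fiberM | rewrite stretchM sb sg mul_c].
- have [d dF sb] := stretch_b b.
  exists (d^-1 * c); first exact/in_fiberM/cF/in_fiberV.
  have dVF := in_fiberV dF.
  rewrite stretchM (morph_inv stretchM) sb sg invgM.
  by rewrite (in_fiber_commute _ dVF) mul_c.
Qed.

Lemma deg_stretch g : deg (stretch g) = (deg g * (n * m).+1%:Z)%R.
Proof.
elim/presented_ind: g => [|b g IHg|b g IHg].
- by rewrite (morph_one stretchM) deg1.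
- by rewrite stretchM !degM stretch_gen degX IHg GRing.mulrDl.
- rewrite stretchM (morph_inv stretchM) !degM !degV stretch_gen degX IHg.
  by rewrite GRing.mulrDl GRing.mulNr.
Qed.

(** A kernel element has degree 0, since degrees are multiplied by a nonzero integer, and it is a
    power of [fiber]; so it is trivial. *)
Lemma stretch_inj : injective stretch.
Proof.
suff ker1 g : stretch g = 1 -> g = 1.
  move=> g h sgh; apply: divg1_eq; apply: ker1.
  by rewrite stretchM (morph_inv stretchM) sgh mulgV.
move=> sg1; have [c cF] := stretch_fiber g; rewrite sg1 => gc1.
have deg_g : deg g = 0%R by have := deg_stretch g; rewrite sg1 deg1; nia.
have deg_c : deg c = 0%R by have := degM g c; rewrite -gc1 deg1 deg_g; lia.
by rewrite gc1 (in_fiber_deg0 cF deg_c) mulg1.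
Qed.

Lemma iter_stretch_deg g k : deg g <> 0%R -> k <= `|deg (iter k stretch g)|.
Proof.
(* The strict bound makes the degree nonzero at every stage, so that multiplying by 1 + nm increases
   it. *)
move=> deg_g; suff: k < `|deg (iter k stretch g)| by move/ltnW.
elim: k => [|k IHk] /=; first by lia.
rewrite deg_stretch abszM /=.
by move: `|deg _| (n * m)%N IHk nm_gt0 => d N; nia.
Qed.

(** * Normal forms modulo the central element *)

Definition valid (s : torus_gen * nat) := 0 < s.2 < ord s.1.

(* Normal forms of the quotient of [T] by [fiber], the free product of cyclic
   groups of orders [n] and [m]: [(b, a)] stands for the syllable [gen b ^+ a]. *)
Definition reduced (w : seq (torus_gen * nat)) :=
  all valid w && sorted (fun s t => s.1 != t.1) w.

(** The argument is the value at the empty word: [first (flip b) w != b] admits empty [w], whereas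
    [first b w = flip b] excludes it. *)
Definition first b (w : seq (torus_gen * nat)) := (head (b, 0) w).1.
Definition final b (w : seq (torus_gen * nat)) := (last (b, 0) w).1.

Lemma reduced_cons b a w :
  reduced ((b, a) :: w) = [&& 0 < a < ord b, first (flip b) w != b & reduced w].
Proof.
rewrite /reduced /= /valid /=; case: w => [|[c d] w] /=.
  by rewrite /first /= flip_neq !andbT.
rewrite /first /= (eq_sym c b).
by case: (0 < a < ord b); case: (b != c); rewrite ?andbF.
Qed.

Lemma reduced_rcons b a w :
  reduced (rcons w (b, a)) = [&& 0 < a < ord b, final (flip b) w != b & reduced w].
Proof.
rewrite /reduced all_rcons /= /valid /=; case: w => [|[c d] w] /=.
  by rewrite /final /= flip_neq !andbT.
rewrite rcons_path /final /=.
by case: (0 < a < _); case: (_ != b); rewrite ?andbF ?andbT.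
Qed.

Definition value (w : seq (torus_gen * nat)) : T := \prod_(s <- w) gen s.1 ^+ s.2.

Lemma value_cons b a w : value ((b, a) :: w) = gen b ^+ a * value w.
Proof. by rewrite /value big_cons. Qed.

Lemma value_rcons b a w : value (rcons w (b, a)) = value w * gen b ^+ a.
Proof. by rewrite /value -cats1 big_cat big_seq1. Qed.

(* The action of [T] on normal forms by left multiplication modulo [fiber]. *)
Definition push (b : torus_gen) a (w : seq (torus_gen * nat)) :=
  if a == ord b then w else (b, a) :: w.

Definition step (b : torus_gen) (w : seq (torus_gen * nat)) :=
  if w is (c, a) :: w' then
    if c == b then push b a.+1 w' else (b, 1%N) :: w
  else [:: (b, 1%N)].

Lemma step_reduced b w : reduced w -> reduced (step b w).
Proof.
have b1 : 0 < 1 < ord b by rewrite ord_gt1.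
case: w => [|[c a] w] /=; first by rewrite reduced_cons b1 /first flip_neq.
case: eqP => [->|/eqP cb] rw; last by rewrite reduced_cons b1 rw /first /= cb.
move: rw; rewrite reduced_cons => /and3P[/andP[_ a_lt] fw rw].
rewrite /push; case: eqP => [//|/eqP a_neq].
by rewrite reduced_cons fw rw (ltn_neqAle a.+1) a_neq a_lt.
Qed.

Lemma iter_step_reduced k b w : reduced w -> reduced (iter k (step b) w).
Proof. by move=> rw; elim: k => //= k; exact: step_reduced. Qed.

Lemma iter_step b a w : 0 < a < ord b -> first (flip b) w != b ->
  iter a (step b) w = (b, a) :: w.
Proof.
move=> /andP[+ +] fw; elim: a => [//|[_ _ _|a IHa _ a_lt]].
  by case: w fw => [|[c d] w] //=; rewrite /first /= => /negPf ->.
rewrite iterS IHa ?(ltnW a_lt) //= eqxx /push.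
by rewrite (ltn_eqF a_lt).
Qed.

(** The iterates of [step b] run through a cycle of length [ord b]: a word not starting with [b],
    then that word preceded by each power of [b]. *)
Lemma iter_step_ord b w : reduced w -> iter (ord b) (step b) w = w.
Proof.
have main u : first (flip b) u != b -> iter (ord b) (step b) u = u.
  move=> fu; have := ord_gt1 b; case E: (ord b) => [|k] // k_gt0.
  by rewrite iterS iter_step ?E ?ltnS ?leqnn ?andbT //= eqxx /push E eqxx.
case: w => [_|[c a] w]; first exact/main/flip_neq.
case: (eqVneq c b) => [->|cb] rw; last exact: main.
move: rw; rewrite reduced_cons => /and3P[va fw _].
by rewrite -iter_step // -iterD addnC iterD main.
Qed.

(** On reduced words [step b] has order dividing [ord b], so its inverse is the iterate of exponent
    [(ord b).-1]. *)
Definition act_letter (a : torus_gen * bool) :=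
  iter (if a.2 then (ord a.1).-1 else 1%N) (step a.1).

Definition act_word (u : word torus_gen) (w : seq (torus_gen * nat)) :=
  foldr act_letter w u.

Lemma act_word_reduced u w : reduced w -> reduced (act_word u w).
Proof. by move=> rw; elim: u => //= a u; exact: iter_step_reduced. Qed.

Lemma act_word_cat u v w : act_word (u ++ v) w = act_word u (act_word v w).
Proof. exact: foldr_cat. Qed.

(** Both sides of the defining relation act as the identity on reduced words. *)
Lemma act_word_eq u v w :
  pres_eq (torus_rel n m) u v -> reduced w -> act_word u w = act_word v w.
Proof.
have act_nseq b k x : act_word (nseq k (b, false)) x = iter k (step b) x.
  by elim: k => //= k ->.
move=> uv; elim: uv w => {u v} [_ _ [-> ->]|b c|u u' v v' _ IHu _ IHv|//|
  u v _ IH|u v w _ IHu _ IHv] x rx.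
- by rewrite !act_nseq (iter_step_ord tx) // (iter_step_ord ty).
- rewrite /act_word /= /act_letter -iterD /= -[RHS](iter_step_ord b rx).
  by congr iter; have := ord_gt0 b; case: c => /=; lia.
- by rewrite !act_word_cat IHv // IHu // act_word_reduced.
- by rewrite IH.
- by rewrite IHu // IHv.
Qed.

Definition nf (g : T) := act_word (repr g) [::].

Lemma nf_pi u : nf (\piT u) = act_word u [::].
Proof. exact: act_word_eq (pres_repr _ u) _. Qed.

Lemma nf_reduced g : reduced (nf g). Proof. exact: act_word_reduced. Qed.

Lemma nf_genX b k g : nf (gen b ^+ k * g) = iter k (step b) (nf g).
Proof.
elim: k => [|k IHk]; first by rewrite mul1g.
rewrite expgS -mulgA iterS -IHk; move: (_ * g); elim/quotW=> u.
by rewrite /gen presM !nf_pi.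
Qed.

Lemma nf_fiber c g : in_fiber c -> nf (c * g) = nf g.
Proof.
have nf_fiberX k h : nf (fiber ^+ k * h) = nf h.
  elim: k => [|k IHk]; first by rewrite mul1g.
  by rewrite expgS -mulgA nf_genX (iter_step_ord tx (nf_reduced _)).
move=> [k [l ->]].
(* A negative power is absorbed by first inserting the opposite positive power. *)
by rewrite -mulgA nf_fiberX -(nf_fiberX l (_ * g)) mulVKg.
Qed.

(** Uniqueness of normal forms: acting on the empty word by the value of [w] rebuilds [w] syllable
    by syllable. *)
Lemma nf_value w : reduced w -> nf (value w) = w.
Proof.
elim: w => [_|[b a] w IHw]; first by rewrite /value big_nil nf_pi.
rewrite reduced_cons => /and3P[va fw rw].
by rewrite value_cons nf_genX IHw // iter_step.
Qed.

(** Equality in the free product of cyclic groups, expressed without forming the quotient. *)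
Definition eqF g h := exists2 c, in_fiber c & g = c * h.

Lemma eqF_refl g : eqF g g.
Proof. by exists 1; [exact: in_fiber1 | rewrite mul1g]. Qed.

Lemma eqF_trans g h k : eqF g h -> eqF h k -> eqF g k.
Proof.
move=> [c cF ->] [d dF ->]; exists (c * d); first exact: in_fiberM.
by rewrite mulgA.
Qed.

Lemma eqFM g h g' h' : eqF g g' -> eqF h h' -> eqF (g * h) (g' * h').
Proof.
move=> [c cF ->] [d dF ->]; exists (c * d); first exact: in_fiberM.
by rewrite -!mulgA (mulgA g') -(in_fiber_commute g' dF) !mulgA.
Qed.

Lemma eqF_conj g h k : eqF g h -> eqF (g ^ k) (h ^ k).
Proof.
move=> [c cF ->]; exists c => //.
by rewrite conjMg in_fiber_conj.
Qed.

Lemma eqF_gen_ord b : eqF (gen b ^+ ord b) 1.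
Proof. by exists fiber; rewrite ?gen_ord ?mulg1 //; exact: (in_fiberX 1). Qed.

Lemma eqF_genV b a : a <= ord b -> eqF (gen b ^- a) (gen b ^+ (ord b - a)).
Proof.
move=> ab; exists fiber^-1; first exact/in_fiberV/(in_fiberX 1).
by rewrite expgnFr // gen_ord mulKg.
Qed.

Lemma value_step b w : eqF (gen b * value w) (value (step b w)).
Proof.
have gen1 u : gen b * value u = value ((b, 1%N) :: u) by rewrite value_cons.
case: w => [|[c a] w] /=; first by rewrite gen1; exact: eqF_refl.
case: eqP => [->|_]; last by rewrite gen1; exact: eqF_refl.
rewrite value_cons mulgA -expgS /push; case: eqP => [->|_].
  by rewrite -[X in eqF _ X]mul1g; apply: eqFM (eqF_refl _); exact: eqF_gen_ord.
by rewrite -value_cons; exact: eqF_refl.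
Qed.

(** Existence of normal forms: modulo [fiber], an inverse letter is a positive power, and each
    [step] preserves the value. *)
Lemma value_nf g : eqF g (value (nf g)).
Proof.
have value_iter k b w : eqF (gen b ^+ k * value w) (value (iter k (step b) w)).
  elim: k => [|k IHk]; first by rewrite mul1g; exact: eqF_refl.
  rewrite expgS -mulgA; apply: eqF_trans (value_step _ _).
  exact: eqFM (eqF_refl _) IHk.
elim/quotW: g => u; rewrite nf_pi pi_word.
elim: u => [|[b c] u IHu].
  by rewrite big_nil /value big_nil; exact: eqF_refl.
rewrite big_cons; apply: eqF_trans (value_iter _ b _); apply: eqFM IHu.
rewrite /letter_val; case: c => /=; last exact: eqF_refl.
by rewrite -subn1; apply: (@eqF_genV b 1); exact: ord_gt0.
Qed.

(** * Conjugates with long normal forms *)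

Definition conj_nf g w := reduced w /\ exists h, eqF (g ^ h) (value w).

Lemma conj_nf_trans g w w' k :
  conj_nf g w -> reduced w' -> eqF (value w ^ k) (value w') -> conj_nf g w'.
Proof.
move=> [_ [h gh]] rw' ww'; split=> //; exists (h * k).
by rewrite conjgM; apply: eqF_trans ww'; exact: eqF_conj.
Qed.

Lemma final_flip b c w : final b w = flip b -> final c w = flip b.
Proof. by case: w => //= fw; have := flip_neq b; rewrite -fw eqxx. Qed.

Lemma reduced_enclose b a d w :
    reduced w -> first b w = flip b -> final b w = flip b ->
    0 < a < ord b -> 0 < d < ord b ->
  reduced ((b, a) :: rcons w (b, d)).
Proof.
move=> rw fw lw va vd; rewrite reduced_cons reduced_rcons va vd rw.
rewrite (final_flip _ lw) flip_neq !andbT /=.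
case: w fw {rw lw} => [/esym/eqP|s w]; first by rewrite (negPf (flip_neq b)).
by rewrite /first /= => ->; rewrite flip_neq.
Qed.

(** Conjugating by the inverse of [gen b] adds a syllable at each end; nothing merges because [w]
    starts and ends with the other generator. *)
Lemma conj_nf_grow g b w :
    conj_nf g w -> first b w = flip b -> final b w = flip b ->
  conj_nf g ((b, 1%N) :: rcons w (b, (ord b).-1)).
Proof.
move=> gw fw lw; have b_gt1 := ord_gt1 b.
apply: (conj_nf_trans (k := (gen b)^-1) gw).
  by case: gw => rw _; apply: reduced_enclose => //; lia.
rewrite conjgE invgK value_cons value_rcons.
apply: eqFM (eqF_refl _) _; apply: eqFM (eqF_refl _) _.
by rewrite -subn1; apply: (@eqF_genV b 1); exact: ord_gt0.
Qed.

Lemma conj_nf_long g b w B :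
    conj_nf g w -> first b w = flip b -> final b w = flip b ->
  exists2 w', conj_nf g w' & B + size w <= size w'.
Proof.
elim: B b w => [|B IHB] b w gw fw lw; first by exists w.
have /= gw' := conj_nf_grow gw fw lw.
(* The enlarged word starts and ends with [b], so the two generators exchange roles. *)
have [||w' gw'' le_w'] := IHB (flip b) _ gw'.
- by rewrite flipK.
- by rewrite /final /= last_rcons flipK.
by exists w' => //; move: le_w'; rewrite /= size_rcons; lia.
Qed.

Lemma conj_nf_rotate g b a w :
  conj_nf g ((b, a) :: w) -> final b w = flip b -> conj_nf g (rcons w (b, a)).
Proof.
move=> gw lw; apply: (conj_nf_trans (k := gen b ^+ a) gw).
  move: (gw.1); rewrite reduced_cons reduced_rcons => /and3P[-> _ ->].
  by rewrite (final_flip _ lw) flip_neq.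
by rewrite conjgE value_cons value_rcons mulgA mulKg; exact: eqF_refl.
Qed.

(* As [gen b] has order at least 3 modulo [fiber], the first syllable can be
   split into two nontrivial powers of [gen b], one of which is moved to the end. *)
Lemma conj_nf_align g b a w :
    2 < ord b -> conj_nf g ((b, a) :: w) -> final b w = flip b ->
  exists w', [/\ conj_nf g w', first (flip b) w' = b & final (flip b) w' = b].
Proof.
move=> b_gt2 gw lw; move: (gw.1).
rewrite reduced_cons => /and3P[/andP[a_gt0 a_lt] fw rw].
have {}fw : first b w = flip b.
  case: w lw fw {gw rw} => [/esym/eqP|s w _]; first by rewrite (negPf (flip_neq b)).
  by rewrite /first /= neq_flip => /eqP.
have ends a' d : first (flip b) ((b, a') :: rcons w (b, d)) = b /\
    final (flip b) ((b, a') :: rcons w (b, d)) = b.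
  by rewrite /final /= last_rcons.
have [a_gt1|a_le1] := ltnP 1 a.
  exists ((b, a.-1) :: rcons w (b, 1%N)).
  have [-> ->] := ends a.-1 1%N; split=> //.
  apply: (conj_nf_trans (k := gen b) gw).
    by apply: reduced_enclose => //; lia.
  rewrite conjgE !value_cons value_rcons expg1 -[in gen b ^+ a](prednK a_gt0).
  by rewrite expgS -!mulgA mulKg; exact: eqF_refl.
have a1 : a = 1%N by lia.
(* Modulo [ord b], the exponent 1 is split as 2 plus [(ord b).-1]; the syllable of exponent 2 is
   valid because [2 < ord b]. *)
exists ((b, 2) :: rcons w (b, (ord b).-1)).
have [-> ->] := ends 2 (ord b).-1; split=> //.
apply: (conj_nf_trans (k := (gen b)^-1) gw).
  by apply: reduced_enclose => //; lia.
rewrite a1 conjgE invgK !value_cons value_rcons expg1 expg2 !mulgA.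
apply: eqFM (eqF_refl _) _.
by rewrite -subn1; apply: (@eqF_genV b 1); exact: ord_gt0.
Qed.

Lemma conj_unbounded g B :
  coprime n m -> g <> 1 -> deg g = 0%R -> exists h, B < size (nf (g ^ h)).
Proof.
move=> co_nm g_neq1 deg_g.
suff [b [w [gw fw lw]]] : exists b w,
    [/\ conj_nf g w, first b w = flip b & final b w = flip b].
  have [w' [rw' [h [c cF gh]]] le_w'] := conj_nf_long B.+1 gw fw lw.
  by exists h; rewrite gh nf_fiber // nf_value //; lia.
(* An empty normal form would make [g] a power of [fiber], hence trivial by its degree. *)
have nf_neq : nf g <> [::].
  move=> nf0; have [c cF] := value_nf g; rewrite nf0 /value big_nil mulg1 => gc.
  by apply: g_neq1; apply: in_fiber_deg0 => //; rewrite gc.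
have gnf : conj_nf g (nf g).
  by split; [exact: nf_reduced | exists 1; rewrite conjg1; exact: value_nf].
case E: (nf g) gnf => [|[b a] w] gw.
  by case: nf_neq.
have [lw|lw] : final b ((b, a) :: w) = b \/ final b ((b, a) :: w) = flip b.
  by move: (final _ _) => c; case: b {E gw}; case: c; auto.
- by exists (flip b), ((b, a) :: w); rewrite flipK.
- have {}lw : final b w = flip b by case: w lw {E gw} => //= /esym.
  have [b_gt2|b_le2] := ltnP 2 (ord b).
    have [w' [gw' fw' lw']] := conj_nf_align b_gt2 gw lw.
    by exists (flip b), w'; rewrite flipK.
  (* Coprimality rules out that both orders are 2. *)
  have fb_gt2 : 2 < ord (flip b).
    have := ord_gt1 (flip b); rewrite leq_eqVlt => /orP[/eqP fb2|//].
    have b2 : ord b = 2 by apply/eqP; rewrite eqn_leq b_le2 ord_gt1.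
    by move: co_nm; case: b {E gw lw b_le2} b2 fb2 => /= -> <-.
  (* Rotation brings a syllable of the generator of order at least 3 to the front. *)
  have {}gw' := conj_nf_rotate gw lw.
  case: w lw gw gw' {E} => [/= /eqP|[c d] w lw gw gw'].
    by rewrite /final /= eq_sym (negPf (flip_neq b)).
  have cb : c = flip b.
    move: (gw.1); rewrite reduced_cons /first /= neq_flip => /and3P[_ /eqP //].
  rewrite rcons_cons cb in gw'.
  have [|w' [gw'' fw' lw']] := conj_nf_align fb_gt2 gw'.
    by rewrite /final last_rcons flipK.
  by rewrite flipK in fw' lw'; exists b, w'.
Qed.

End TorusKnot.

Theorem corollary1p3 (n m : nat) (n_gt1 : (1 < n)%N) (m_gt1 : (1 < m)%N)
    (co_nm : coprime n m) (phi : formula unit) :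
  existential phi -> concise phi (torus_knot_group n m).
Proof.
move=> ex_phi sol_fin; apply: (concise_trivial _ sol_fin) => g sol_g.
apply: contrapT => g_neq1.
case: (eqVneq (deg g) 0%R) => [deg_g|/eqP deg_g].
  (* Conjugations are injective endomorphisms, so all conjugates of [g] are solutions. *)
  have [B le_B] := finite_set_bounded (fun h => size (nf h)) sol_fin.
  have [h] := conj_unbounded n_gt1 m_gt1 B co_nm g_neq1 deg_g.
  apply/negP; rewrite -leqNgt; apply: le_B.
  apply: (solutions_morph (s := conjg^~ h)) => //.
    by move=> x y; exact: conjMg.
  exact: conjg_inj.
have [B le_B] := finite_set_bounded (fun h => `|deg h|%N) sol_fin.
have sol_iter k : solutions phi (torus_knot_group n m) (iter k (@stretch n m) g).
  elim: k => //= k; apply: solutions_morph => //; first exact: stretchM.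
  exact: stretch_inj.
have := iter_stretch_deg n_gt1 m_gt1 B.+1 deg_g.
by move/leq_trans => /(_ _ (le_B _ (sol_iter _))); rewrite ltnn.
Qed.
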